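(* Let $\mathbf{k}=(k_1,\dots,k_m)$ be an index (tuple of positive integers). Then the following functional equation holds in $\mathcal{A}_{2,\mathbb{Z}[t]}$: $$\widetilde{\pounds}^{\star}_{\mathcal{A}_2,\mathbf{k}}(t)+\bigl(\widetilde{\pounds}^{\star}_{\mathcal{A}_2,(1,k_1,\dots,k_m)}(t)-\widetilde{\pounds}^{\star}_{\mathcal{A}_2,(k_1+1,k_2,\dots,k_m)}(t)\bigr)\mathbf{p}=\widetilde{\pounds}^{\star}_{\mathcal{A}_2,\mathbf{k}^{\vee}}(1-t)-\zeta^{\star}_{\mathcal{A}_2}(\mathbf{k}^{\vee}).$$
   Context: For a commutative ring $R$, $\mathcal{A}_{2,R}=\left(\prod_pR/p^2R\right)/\left(\bigoplus_pR/p^2R\right)$, $p$ running over all primes, and $\mathcal{A}_2=\mathcal{A}_{2,\mathbb{Z}}$; elements are written $(a_p)_p$, and two are equal iff their components agree for all but finitely many $p$. $\mathbf{p}=(p\bmod p^2)_p$. For an index $\mathbf{k}=(k_1,\dots,k_m)$, $$\widetilde{\pounds}^{\star}_{\mathcal{A}_2,\mathbf{k}}(t)=\Bigl(\sum_{p-1\ge n_1\ge\cdots\ge n_m\ge1}\frac{t^{n_m}}{n_1^{k_1}\cdots n_m^{k_m}}\bmod p^2\Bigr)_p\in\mathcal{A}_{2,\mathbb{Z}[t]},\qquad \zeta^{\star}_{\mathcal{A}_2}(\mathbf{k})=\widetilde{\pounds}^{\star}_{\mathcal{A}_2,\mathbf{k}}(1)\in\mathcal{A}_2.$$ Hoffman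 dual: for an index $\mathbf{k}$ of weight $w=k_1+\cdots+k_m$ put $\psi(\mathbf{k})=\{k_1,k_1+k_2,\dots,k_1+\cdots+k_{m-1}\}$; $\psi$ is a bijection from indices of weight $w$ onto subsets of $\{1,\dots,w-1\}$, and $\mathbf{k}^{\vee}$ is the index of weight $w$ with $\psi(\mathbf{k}^{\vee})=\{1,\dots,w-1\}\setminus\psi(\mathbf{k})$. *)

(* Defs.v *)
From HB Require Import structures.
From mathcomp Require Import all_boot all_order all_algebra.
From mathcomp Require Import boolp classical_sets cardinality.

Set Implicit Arguments.
Unset Strict Implicit.
Unset Printing Implicit Defensive.

Import GRing.Theory.
Local Open Scope ring_scope.
Local Open Scope quotient_scope.

(* Quotient of a commutative ring by an ideal. The library's {ideal_quot I}
   only provides a ring when I is proper; here I may contain 1, because p^2 R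
   can be the whole of R. *)

HB.mixin Record isIdeal (R : comPzRingType) (S : R -> bool) := {
  idealM_subproof : forall a u, u \in S -> a * u \in S
}.

#[short(type="idealType")]
HB.structure Definition Ideal (R : comPzRingType) :=
  {S of GRing.ZmodClosed R S & isIdeal R S}.

Definition ring_quot (R : comPzRingType) (I : idealType R) := Quotient.quot I.

Section RingQuot.
Variables (R : comPzRingType) (I : idealType R).
Local Notation Q := (ring_quot I).

HB.instance Definition _ := GRing.Zmodule.on Q.
HB.instance Definition _ : EqQuotient R (Quotient.equiv I) Q :=
  EqQuotient.on Q.

Lemma ring_quot_eq (x y : R) : (\pi_Q x == \pi_Q y) = (x - y \in I).
Proof. by rewrite Quotient.idealrBE. Qed.

Definition ring_quot_one : Q := lift_cst Q 1.
Definition ring_quot_mul : Q -> Q -> Q := lift_op2 Q *%R.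

Lemma ring_quot_piM (x y : R) :
  \pi_Q (x * y) = ring_quot_mul (\pi_Q x) (\pi_Q y).
Proof.
unlock ring_quot_mul; apply/eqP; rewrite ring_quot_eq.
set x' := repr _; set y' := repr _.
have hx : x - x' \in I by rewrite -ring_quot_eq reprK.
have hy : y - y' \in I by rewrite -ring_quot_eq reprK.
have -> : x * y - x' * y' = y * (x - x') + x' * (y - y').
  by rewrite !mulrBr (mulrC y x) (mulrC y x') addrA subrK.
by rewrite rpredD // idealM_subproof.
Qed.

Lemma ring_quot_pi1 : \pi_Q 1 = ring_quot_one.
Proof. by unlock ring_quot_one. Qed.

Lemma ring_quot_piD (x y : R) : \pi_Q (x + y) = \pi_Q x + \pi_Q y.
Proof. by rewrite (@Quotient.pi_add _ I). Qed.

Lemma ring_quot_mulA : associative ring_quot_mul.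
Proof.
by move=> x y z; rewrite -[x]reprK -[y]reprK -[z]reprK -!ring_quot_piM mulrA.
Qed.

Lemma ring_quot_mulC : commutative ring_quot_mul.
Proof. by move=> x y; rewrite -[x]reprK -[y]reprK -!ring_quot_piM mulrC. Qed.

Lemma ring_quot_mul1 : left_id ring_quot_one ring_quot_mul.
Proof. by move=> x; rewrite -[x]reprK -ring_quot_pi1 -ring_quot_piM mul1r. Qed.

Lemma ring_quot_mulDl : left_distributive ring_quot_mul +%R.
Proof.
move=> x y z; rewrite -[x]reprK -[y]reprK -[z]reprK.
by rewrite -ring_quot_piD -!ring_quot_piM -ring_quot_piD mulrDl.
Qed.

Lemma ring_quot_mulDr : right_distributive ring_quot_mul +%R.
Proof. by move=> x y z; rewrite !(ring_quot_mulC x) ring_quot_mulDl. Qed.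

Lemma ring_quot_mulr1 : right_id ring_quot_one ring_quot_mul.
Proof. by move=> x; rewrite ring_quot_mulC ring_quot_mul1. Qed.

HB.instance Definition _ := GRing.Zmodule_isPzRing.Build Q
  ring_quot_mulA ring_quot_mul1 ring_quot_mulr1 ring_quot_mulDl ring_quot_mulDr.
HB.instance Definition _ :=
  GRing.PzRing_hasCommutativeMul.Build Q ring_quot_mulC.

Definition to_quot (x : R) : Q := \pi_Q x.

Lemma to_quot_zmod_morphism : zmod_morphism to_quot.
Proof.
by move=> x y; apply/eqP; rewrite eq_sym subr_eq -ring_quot_piD subrK.
Qed.
HB.instance Definition _ :=
  GRing.isZmodMorphism.Build R Q to_quot to_quot_zmod_morphism.

Lemma to_quot_monoid_morphism : monoid_morphism to_quot.
Proof. by split=> [|x y]; [exact: ring_quot_pi1|exact: ring_quot_piM]. Qed.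
HB.instance Definition _ :=
  GRing.isMonoidMorphism.Build R Q to_quot to_quot_monoid_morphism.

Lemma to_quot_eq (x y : R) : to_quot x = to_quot y <-> x - y \in I.
Proof. by rewrite -ring_quot_eq; split=> [/eqP|/eqP]. Qed.

End RingQuot.

Definition prod_ring (T : Type) (B : T -> comPzRingType) := forall i, B i.

Section ProdRing.
Variables (T : Type) (B : T -> comPzRingType).
Local Notation P := (prod_ring B).

HB.instance Definition _ := gen_eqMixin P.
HB.instance Definition _ := gen_choiceMixin P.

Let add (a b : P) : P := fun i => a i + b i.
Let opp (a : P) : P := fun i => - a i.
Let mul (a b : P) : P := fun i => a i * b i.

Fact prod_addA : associative add.
Proof. by move=> a b c; apply: functional_extensionality_dep => i; apply: addrA. Qed.
Fact prod_addC : commutative add.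
Proof. by move=> a b; apply: functional_extensionality_dep => i; apply: addrC. Qed.
Fact prod_add0 : left_id (fun i => 0) add.
Proof. by move=> a; apply: functional_extensionality_dep => i; apply: add0r. Qed.
Fact prod_addN : left_inverse (fun i => 0) opp add.
Proof. by move=> a; apply: functional_extensionality_dep => i; apply: addNr. Qed.
HB.instance Definition _ :=
  GRing.isZmodule.Build P prod_addA prod_addC prod_add0 prod_addN.

Fact prod_mulA : associative mul.
Proof. by move=> a b c; apply: functional_extensionality_dep => i; apply: mulrA. Qed.
Fact prod_mul1 : left_id (fun i => 1) mul.
Proof. by move=> a; apply: functional_extensionality_dep => i; apply: mul1r. Qed.
Fact prod_mulr1 : right_id (fun i => 1) mul.
Proof. by move=> a; apply: functional_extensionality_dep => i; apply: mulr1. Qed.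
Fact prod_mulDl : left_distributive mul +%R.
Proof. by move=> a b c; apply: functional_extensionality_dep => i; apply: mulrDl. Qed.
Fact prod_mulDr : right_distributive mul +%R.
Proof. by move=> a b c; apply: functional_extensionality_dep => i; apply: mulrDr. Qed.
Fact prod_mulC : commutative mul.
Proof. by move=> a b; apply: functional_extensionality_dep => i; apply: mulrC. Qed.
HB.instance Definition _ := GRing.Zmodule_isPzRing.Build P
  prod_mulA prod_mul1 prod_mulr1 prod_mulDl prod_mulDr.
HB.instance Definition _ := GRing.PzRing_hasCommutativeMul.Build P prod_mulC.

Lemma prod_addE (a b : P) i : (a + b) i = a i + b i. Proof. by []. Qed.
Lemma prod_oppE (a : P) i : (- a) i = - a i. Proof. by []. Qed.
Lemma prod_mulE (a b : P) i : (a * b) i = a i * b i. Proof. by []. Qed.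

Definition dsum : P -> bool := fun a => `[< finite_set [set i | a i <> 0] >].

Fact dsum_zmod_closed : zmod_closed dsum.
Proof.
split.
  by apply/asboolP; apply: (sub_finite_set (B := set0)) => // i /=.
move=> a b /asboolP ha /asboolP hb; apply/asboolP.
apply: (sub_finite_set (B := [set i | a i <> 0] `|` [set i | b i <> 0])).
  move=> i /= hab; apply: contrapT => /not_orP[/contrapT ea /contrapT eb].
  by apply: hab; rewrite prod_addE prod_oppE ea eb subr0.
by rewrite finite_setU.
Qed.
HB.instance Definition _ := GRing.isZmodClosed.Build P dsum dsum_zmod_closed.

Fact dsum_ideal a u : u \in dsum -> a * u \in dsum.
Proof.
move=> /asboolP hu; apply/asboolP; apply: sub_finite_set hu => i /= h eu.
by apply: h; rewrite prod_mulE eu mulr0.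
Qed.
HB.instance Definition _ := isIdeal.Build P dsum dsum_ideal.

End ProdRing.

Definition sq_ideal (R : comPzRingType) (p : nat) : R -> bool :=
  fun x => `[< exists y, x = (p ^ 2)%:R * y >].

Section SqIdeal.
Variables (R : comPzRingType) (p : nat).

Fact sq_ideal_zmod_closed : zmod_closed (@sq_ideal R p).
Proof.
split; first by apply/asboolP; exists 0; rewrite mulr0.
move=> x y /asboolP[a ->] /asboolP[b ->]; apply/asboolP.
by exists (a - b); rewrite mulrBr.
Qed.
HB.instance Definition _ :=
  GRing.isZmodClosed.Build R (@sq_ideal R p) sq_ideal_zmod_closed.

Fact sq_idealM a u : u \in @sq_ideal R p -> a * u \in @sq_ideal R p.
Proof.
by move=> /asboolP[b ->]; apply/asboolP; exists (a * b); rewrite mulrCA.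
Qed.
HB.instance Definition _ := isIdeal.Build R (@sq_ideal R p) sq_idealM.
End SqIdeal.

Definition modsq (R : comPzRingType) (p : nat) : comPzRingType :=
  ring_quot (Ideal.clone R (@sq_ideal R p) _).

Definition primeT := {p : nat | prime p}.

Definition prod_modsq (R : comPzRingType) : comPzRingType :=
  prod_ring (fun p : primeT => modsq R (val p)).

Definition A2 (R : comPzRingType) : comPzRingType :=
  ring_quot (Ideal.clone (prod_modsq R) (@dsum _ (fun p : primeT => modsq R (val p))) _).

Section A2Theory.
Variable R : comPzRingType.

Definition toA2 (a : forall p : primeT, modsq R (val p)) : A2 R :=
  to_quot _ (a : prod_modsq R).

Lemma toA2_eq (a b : forall p : primeT, modsq R (val p)) :
  toA2 a = toA2 b <-> finite_set [set p | a p <> b p].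
Proof.
rewrite /toA2 to_quot_eq.
have -> : [set p | a p <> b p]%classic =
    [set p | ((a : prod_modsq R) - (b : prod_modsq R)) p <> 0]%classic.
  apply/seteqP; split=> p /= h e; apply: h.
    by apply/eqP; rewrite -subr_eq0; apply/eqP; exact: e.
  by rewrite prod_addE prod_oppE e subrr.
by split=> [/asboolP|/asboolP].
Qed.

Definition to_modsq (p : nat) (x : R) : modsq R p := to_quot _ x.

Lemma to_modsq_eq (p : nat) (x y : R) :
  to_modsq p x = to_modsq p y <-> exists z, x - y = (p ^ 2)%:R * z.
Proof. by rewrite /to_modsq to_quot_eq; split=> [/asboolP|/asboolP]. Qed.

Definition boldp : A2 R := toA2 (fun p => (val p)%:R).

End A2Theory.

(* Functoriality of A2, used to view A2 int inside A2 {poly int}. *)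
Section A2Map.
Variables (R S : comPzRingType) (f : {rmorphism R -> S}).

Definition modsq_map (p : nat) (a : modsq R p) : modsq S p :=
  to_modsq p (f (repr a)).

Definition A2_map (a : A2 R) : A2 S :=
  toA2 (fun p => modsq_map ((repr a : prod_modsq R) p)).

Lemma modsq_mapE (p : nat) (x : R) :
  modsq_map (to_modsq p x) = to_modsq p (f x).
Proof.
apply/to_modsq_eq.
have : to_modsq p (repr (to_modsq p x)) = to_modsq p x by exact: reprK.
by case/to_modsq_eq=> z hz; exists (f z); rewrite -rmorphB hz rmorphM rmorph_nat.
Qed.

Lemma A2_mapE (x : primeT -> R) :
  A2_map (toA2 (fun p => to_modsq (val p) (x p))) =
  toA2 (fun p => to_modsq (val p) (f (x p))).
Proof.
set a := toA2 _.
have : toA2 (repr a : prod_modsq R) = a by exact: reprK.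
move=> /toA2_eq ha; apply/toA2_eq; apply: sub_finite_set ha => p /= h e.
by apply: h; rewrite e modsq_mapE.
Qed.

End A2Map.

(* An index is a nonempty sequence of positive integers. *)
Definition is_index (k : seq nat) : bool := (k != [::]) && all (leq 1) k.

(* The inverse of x when x is invertible, and 0 otherwise: B may be the zero
   ring, so that the library's unitRingType is not available. *)
Definition ring_inv (B : comPzRingType) (x : B) : B :=
  xget 0 [set y | x * y = 1]%classic.

Lemma ring_invP (B : comPzRingType) (x y : B) : x * y = 1 -> ring_inv x = y.
Proof.
move=> xy; rewrite /ring_inv; apply: xget_unique => //= z xz.
by rewrite -[z]mul1r -xy mulrAC xz mul1r.
Qed.

Lemma modsq_unit (R : comPzRingType) (p n : nat) :
  prime p -> (0 < n < p)%N -> n%:R * ring_inv n%:R = 1 :> modsq R p.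
Proof.
move=> p_pr /andP[n0 np].
have cop : coprime n (p ^ 2).
  by rewrite coprimeXr // coprime_sym prime_coprime // gtnNdvd.
have [u v e _] := egcdnP (p ^ 2) n0.
have hu : n%:R * u%:R = 1 :> modsq R p.
  rewrite -natrM mulnC e (eqP cop) natrD -[RHS]add0r; congr (_ + _).
  rewrite -[LHS](rmorph_nat (@to_quot R (Ideal.clone R (@sq_ideal R p) _))).
  rewrite -[RHS](rmorph0 (@to_quot R (Ideal.clone R (@sq_ideal R p) _))).
  apply/to_quot_eq; apply/asboolP; exists v%:R.
  by rewrite subr0 -natrM mulnC.
by rewrite (ring_invP hu).
Qed.

(* The sum over p - 1 >= n_1 >= ... >= n_m >= 1 of
   x ^ n_m / (n_1 ^ k_1 ... n_m ^ k_m), in a commutative ring B in which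
   1, ..., p - 1 are invertible. *)
Definition star_sum (B : comPzRingType) (p : nat) (k : seq nat) (x : B) : B :=
  \sum_(n : (size k).-tuple 'I_p
         | all (leq 1) (map val n) && sorted geq (map val n))
    x ^+ last 0%N (map val n) *
    ring_inv (\prod_(i < size k) (tnth n i)%:R ^+ nth 0%N k i).

(* polylog k x is the value at x of the finite star polylogarithm of index k;
   the polylogarithm itself is obtained for R = {poly int} and x = 'X. *)
Definition polylog (R : comPzRingType) (k : seq nat) (x : R) : A2 R :=
  toA2 (fun p => star_sum (val p) k (to_modsq (val p) x)).

Definition zeta (k : seq nat) : A2 int := polylog k 1.

(* psi k, as the increasing sequence of its elements. *)
Definition psi (k : seq nat) : seq nat :=
  [seq sumn (take i k) | i <- iota 1 (size k).-1].

(* The index of weight w whose image by psi is the increasing sequence s. *)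
Definition index_of (w : nat) (s : seq nat) : seq nat :=
  pairmap (fun a b => b - a)%N 0%N (rcons s w).

Definition hoffman_dual (k : seq nat) : seq nat :=
  index_of (sumn k) [seq j <- iota 1 (sumn k).-1 | j \notin psi k].

Lemma psi_scanl (k : seq nat) :
  psi k = take (size k).-1 (scanl addn 0%N k).
Proof.
apply: (@eq_from_nth _ 0%N) => [|i].
  by rewrite size_map size_iota size_take_min size_scanl; case: (size k) => //= n; rewrite (minn_idPl _).
rewrite size_map size_iota => hi.
rewrite (nth_map 0%N) ?size_iota // nth_iota // nth_take // add1n.
rewrite nth_scanl; last by apply: leq_trans hi (leq_pred _).
by rewrite -[LHS]addn0 [RHS]foldlE /= big_cons add0n sumnE addn0.
Qed.

Lemma index_ofK (w : nat) (s : seq nat) :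
  sorted ltn (0%N :: rcons s w) ->
  [/\ is_index (index_of w s), sumn (index_of w s) = w
    & psi (index_of w s) = s].
Proof.
rewrite /index_of => /= hs.
have scK x : path ltn x (rcons s w) ->
    scanl addn x (pairmap (fun a b => b - a)%N x (rcons s w)) = rcons s w.
  by elim: (rcons s w) x => //= y r IH x /andP[xy hr]; rewrite subnKC ?IH // ltnW.
have sz : size (pairmap (fun a b => b - a)%N 0%N (rcons s w)) = (size s).+1.
  by rewrite size_pairmap size_rcons.
have pos x : path ltn x (rcons s w) ->
    all (leq 1) (pairmap (fun a b => b - a)%N x (rcons s w)).
  by elim: (rcons s w) x => //= y r IH x /andP[xy hr]; rewrite subn_gt0 xy IH.
have sm x : path ltn x (rcons s w) ->
    (x + sumn (pairmap (fun a b => b - a)%N x (rcons s w)) = last x (rcons s w))%N.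
  elim: (rcons s w) x => [|y r IH] x /=; first by rewrite addn0.
  by move=> /andP[xy hr]; rewrite addnA subnKC ?IH // ltnW.
split.
- by rewrite /is_index pos // andbT -size_eq0 sz.
- by rewrite -[LHS]add0n sm // last_rcons.
- by rewrite psi_scanl sz scK //= -cats1 take_size_cat.
Qed.

Lemma hoffman_dualP (k : seq nat) (hk : is_index k) :
  [/\ is_index (hoffman_dual k), sumn (hoffman_dual k) = sumn k
    & forall j, (j \in psi (hoffman_dual k)) =
                (0 < j < sumn k)%N && (j \notin psi k)].
Proof.
have w_gt0 : (0 < sumn k)%N.
  by case: k hk => [|a k] //= /andP[_ /andP[a0 _]]; rewrite ltn_addr.
set s := [seq j <- iota 1 (sumn k).-1 | j \notin psi k].
have ms j : (j \in s) = (0 < j < sumn k)%N && (j \notin psi k).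
  by rewrite mem_filter mem_iota add1n prednK // andbC.
have hs : sorted ltn (0%N :: rcons s (sumn k)).
  rewrite /= rcons_path (path_sortedE ltn_trans) -andbA; apply/and3P; split.
  - by apply/allP => j; rewrite ms => /andP[/andP[]].
  - by apply: (sorted_filter ltn_trans); exact: iota_ltn_sorted.
  - have := mem_last 0%N s; rewrite inE => /predU1P[->//|].
    by rewrite ms => /andP[/andP[]].
have [h1 h2 h3] := index_ofK hs.
by split=> // j; rewrite -ms -[in RHS]h3.
Qed.

(* Together with hoffman_dualP, this characterizes the Hoffman dual. *)
Lemma psi_inj (k l : seq nat) : is_index k -> is_index l ->
  sumn k = sumn l -> psi k =i psi l -> k = l.
Proof.
have scl (m : seq nat) : is_index m -> scanl addn 0%N m = rcons (psi m) (sumn m).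
  case/lastP: m => // m a _; rewrite psi_scanl size_rcons /=.
  rewrite -cats1 scanl_cat /= cats1 -[in take _ _](size_scanl addn 0%N m).
  rewrite -cats1 take_size_cat // cats1 sumn_cat /= addn0; congr (rcons _ (_ + _)%N).
  by rewrite -sumn_rev; elim/last_ind: m => // m b IH; rewrite rev_rcons /= addnC foldl_rcons IH.
have srt (m : seq nat) : is_index m -> sorted ltn (psi m).
  move=> hm; have : path ltn 0%N (scanl addn 0%N m).
    case/andP: hm => _; move: {2 3}0%N; elim: m => //= a m IH x /andP[a0 hm].
    by apply/andP; split; [rewrite -addn1 leq_add2l|exact: IH].
  by rewrite scl // rcons_path => /andP[/path_sorted].
move=> hk hl ew ep.
have eps : psi k = psi l.
  apply: (irr_sorted_eq ltn_trans ltnn) => //; exact: srt.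
have : scanl addn 0%N k = scanl addn 0%N l by rewrite !scl // eps ew.
elim: k l {hk hl ew ep eps} 0%N => [|a k IH] [|b l] x //= [/addnI -> /IH -> //].
Qed.

(* Main.v *)
From HB Require Import structures.
Require Import Defs.
From mathcomp Require Import all_boot all_order all_algebra.
From mathcomp Require Import boolp classical_sets cardinality ring.

Import GRing.Theory.
Local Open Scope ring_scope.

(** The identity is proved prime by prime, in B = Z[t]/p^2 for p odd. On
functions of n >= 1 consider the operators D : f |-> (n |-> f n / n)
([dividx]), S : f |-> (n |-> f 1 + ... + f n) ([psum]) and the binomial
transform T f n = sum_{1 <= j <= n} (-1)^j C(n, j) f j ([binomt]).

The star sum of index k is S s evaluated at p - 1, where s arises from
g n = t^n by applying D and then w - 1 letters, each of them D or D S, w being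
the weight of k; the letter in position j is D S exactly when j is in psi k.
The Hoffman dual therefore exchanges the two letters ([word_dual]). The
transform does the same: T D = S D T ([binomt_dividx]) and
T S h n = T h n - T h (n - 1) ([binomt_psum]) give T s = S s', where s' is made
of the exchanged letters applied to T g n = (1 - t)^n - 1 ([nest_duality]).
At p - 1, S s' is the right-hand side of the theorem.

For the left-hand side, let H be the harmonic numbers. Summation by parts turns
the coefficient of p into the sum of s n (H_{p-1} - H_n)
([harmonic_summation]); moreover (-1)^n C(p-1, n) = 1 - p H_n modulo p^2
([binomial_harmonic]), and n = p - 1 gives p H_{p-1} = 0 since p is odd
([harmonic_pred]). So the left-hand side is the sum of (-1)^n C(p-1, n) s n,
that is, T s at p - 1 ([star_sum_duality]). *)

(** * Indices as words in two letters *)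

Section Words.

Set Implicit Arguments.
Unset Strict Implicit.

(** The letter [true] in position j, counted from 1, means that j is a partial
sum of the index. An index of weight w has a word of length w - 1: the last
block loses one letter because w itself is not in psi. *)
Fixpoint word (k : seq nat) : seq bool :=
  if k is a :: k' then
    nseq a.-1 false ++ (if k' is [::] then [::] else true :: word k')
  else [::].

Lemma word_psi k : is_index k ->
  word k = [seq j \in psi k | j <- iota 1 (sumn k).-1].
Proof.
elim: k => // a k IH /andP[_ /= /andP[a0 hk]].
case: k IH hk => [|b k] IH hk.
  rewrite /= addn0 cats0 /psi /=.
  by elim: (a.-1) 1%N => //= n IHn m; rewrite -IHn.
have s0 : (0 < sumn (b :: k))%N by case/andP: hk => b0 _; rewrite /= ltn_addr.
rewrite IH //.
have psiE : psi [:: a, b & k] = a :: map (addn a) (psi (b :: k)).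
  rewrite /psi /= addn0; congr (_ :: _).
  by rewrite -map_comp (iotaDl 1 1) -map_comp; apply: eq_map => i.
have -> : ((a + sumn (b :: k)).-1 = a.-1 + (sumn (b :: k)).-1.+1)%N.
  by rewrite prednK // -[in RHS]subn1 addnBAC // subn1.
rewrite iotaD map_cat add1n prednK // psiE.
congr (_ ++ _).
  have -> : nseq a.-1 false = [seq false | j <- iota 1 a.-1].
    by elim: (a.-1) 1%N => //= n IHn m; rewrite -IHn.
  apply/eq_in_map => j; rewrite mem_iota add1n prednK // => /andP[_ ja].
  rewrite inE ltn_eqF //=; apply/esym/negP => /mapP[i _ e].
  by move: ja; rewrite e ltnNge leq_addr.
rewrite /= mem_head; congr (_ :: _).
rewrite -[a.+1]addn1 iotaDl -map_comp; apply/eq_in_map => j.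
rewrite mem_iota => /andP[j0 _] /=.
have ne : (a + j == a)%N = false by rewrite -{2}[a]addn0 eqn_add2l gtn_eqF.
by rewrite inE (mem_map (@addnI a)) ne.
Qed.

Lemma word_dual k : is_index k -> word (hoffman_dual k) = map negb (word k).
Proof.
move=> hk; have [hd es em] := hoffman_dualP hk.
rewrite !word_psi // es -map_comp; apply/eq_in_map => j.
rewrite mem_iota /= em => /andP[j0]; rewrite j0 /=.
by case: (sumn k) => [|w]; [case: (j) j0 | move->].
Qed.

End Words.

(** * Partial sums and the binomial transform *)

Definition units_below (B : comPzRingType) (p : nat) : Prop :=
  forall n, (0 < n < p)%N -> n%:R * ring_inv n%:R = 1 :> B.

Section Operators.

Set Implicit Arguments.
Unset Strict Implicit.

Variable B : comPzRingType.
Implicit Types (f g h : nat -> B) (x : B).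

Definition dividx f : nat -> B := fun n => ring_inv n%:R * f n.

Definition psum f : nat -> B := fun n => \sum_(1 <= j < n.+1) f j.

Definition binomt f : nat -> B :=
  fun n => \sum_(1 <= j < n.+1) (-1) ^+ j * 'C(n, j)%:R * f j.

Definition harmonic : nat -> B := psum (dividx (fun=> 1)).

Lemma psum0 f : psum f 0 = 0. Proof. by rewrite /psum big_geq. Qed.

Lemma psumS f n : psum f n.+1 = psum f n + f n.+1.
Proof. by rewrite /psum big_nat_recr. Qed.

Lemma psum_eq f g N : (forall n, (0 < n <= N)%N -> f n = g n) ->
  psum f N = psum g N.
Proof. by move=> e; apply: eq_big_nat => j; rewrite ltnS => /e. Qed.

Lemma psumB f g N : psum (fun n => f n - g n) N = psum f N - psum g N.
Proof. by rewrite /psum sumrB. Qed.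

Lemma binomt0 f : binomt f 0 = 0. Proof. by rewrite /binomt big_geq. Qed.

(** Pascal's rule; the function on the right is summed up to N.+1 because
C(N, N.+1) = 0 lets both transforms be summed over the same range. *)
Lemma binomt_diff f N : binomt f N.+1 - binomt f N =
  psum (fun j => (-1) ^+ j * 'C(N, j.-1)%:R * f j) N.+1.
Proof.
have -> : binomt f N = psum (fun j => (-1) ^+ j * 'C(N, j)%:R * f j) N.+1.
  by rewrite psumS bin_small // mulr0 mul0r addr0.
rewrite -[binomt f N.+1]/(psum _ N.+1) -psumB; apply: psum_eq => -[//|j] _.
by rewrite binS natrD /=; ring.
Qed.

(** The increments of both sides at N agree, as C(N - 1, j - 1) / j is
C(N, j) / N. *)
Lemma binomt_dividx f p N : units_below B p -> (N < p)%N ->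
  binomt (dividx f) N = psum (dividx (binomt f)) N.
Proof.
move=> up; elim: N => [|N IH] Np; first by rewrite binomt0 psum0.
rewrite psumS -IH 1?ltnW // addrC; apply: (canRL (subrK _)).
rewrite binomt_diff /dividx /binomt mulr_sumr.
apply: eq_big_nat => -[//|j]; rewrite !ltnS /= => jN.
have uj := up j.+1 (leq_ltn_trans (jN : (j < N.+1)%N) Np).
have uN := up N.+1 (Np : (0 < N.+1 < p)%N).
have e : N.+1%:R * 'C(N, j)%:R = j.+1%:R * 'C(N.+1, j.+1)%:R :> B.
  by rewrite -!natrM (mul_bin_diag N.+1).
set u := ring_inv _ in uj *; set v := ring_inv _ in uN *.
have {e} -> : 'C(N, j)%:R = v * (j.+1%:R * 'C(N.+1, j.+1)%:R) :> B.
  by rewrite -e mulrA (mulrC v) uN mul1r.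
by rewrite -[RHS]mul1r; rewrite -[X in _ = X * _]uj; ring.
Qed.

(** Exchanging the two sums leaves, as coefficient of h j, an alternating sum
of binomial coefficients that telescopes; [part] is the corresponding partial
summation. *)
Lemma binomt_psum h N : binomt (psum h) N.+1 = binomt h N.+1 - binomt h N.
Proof.
rewrite binomt_diff.
have part M : psum (fun j => (-1) ^+ j * 'C(N.+1, j)%:R * psum h j) M =
    psum (fun j => (-1) ^+ j * 'C(N, j.-1)%:R * h j) M
    + (-1) ^+ M * 'C(N, M)%:R * psum h M.
  elim: M => [|M IH]; first by rewrite !psum0 mulr0 addr0.
  by rewrite ![psum _ M.+1]psumS IH binS natrD exprS /=; ring.
by rewrite [LHS]part bin_small // mulr0 mul0r addr0.
Qed.

Lemma binomt_pow x N : binomt (fun n => x ^+ n) N = (1 - x) ^+ N - 1.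
Proof.
rewrite exprDn -(big_mkord xpredT (fun i => 1 ^+ (N - i) * (- x) ^+ i *+ 'C(N, i))).
rewrite big_ltn // bin0 expr1n mul1r expr0 mulr1n addrAC subrr add0r.
apply: eq_big_nat => j _; rewrite expr1n mul1r [in RHS]exprNn -[RHS]mulr_natr.
by rewrite mulrAC.
Qed.

(** The word is read from the outside in: its first letter is applied last. *)
Definition nest g (w : seq bool) : nat -> B :=
  foldr (fun b f => dividx (if b then psum f else f)) (dividx g) w.

(** Induction on the word. A letter D becomes S D T = S (D S) after the
transform, since T h = S h' for the remaining word; a letter D S becomes
S D T S = S D, since T S h is the difference of T h = S h', which is h'. *)
Lemma nest_duality g w p N : units_below B p -> (N < p)%N ->
  binomt (nest g w) N = psum (nest (binomt g) (map negb w)) N.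
Proof.
move=> up; elim: w N => [|b w IH] N Np; first exact: binomt_dividx up Np.
rewrite /= (binomt_dividx _ up Np).
apply: psum_eq => -[//|n] /= nN; rewrite /dividx; congr (_ * _).
have np := leq_ltn_trans nN Np.
case: b; last exact: IH.
by rewrite /= binomt_psum !IH ?psumS ?(ltnW np) // addrC addKr.
Qed.

Lemma nestB f g w n : nest (fun n => f n - g n) w n = nest f w n - nest g w n.
Proof.
elim: w n => [|b w IH] n; first by rewrite /= /dividx mulrBr.
rewrite /= /dividx -mulrBr; congr (_ * _); case: b => //.
by rewrite -psumB; apply: eq_bigr => j _.
Qed.

Lemma eq_nest f g w n : (0 < n)%N -> (forall j, (0 < j)%N -> f j = g j) ->
  nest f w n = nest g w n.
Proof.
move=> + e; elim: w n => [|b w IH] n n0 /=; rewrite /dividx; first by rewrite e.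
by case: b; rewrite ?IH //; congr (_ * _); apply: psum_eq => j /andP[j0 _]; apply: IH.
Qed.

(** The left-hand side is the sum of f j / n over j < n; for a fixed j the
1 / n add up to H_N - H_j. *)
Lemma harmonic_summation f N :
  psum (dividx (psum f)) N - psum (dividx f) N
  = harmonic N * psum f N - psum (fun n => harmonic n * f n) N.
Proof.
elim: N => [|N IH]; first by rewrite !psum0 mulr0 !subr0.
have /(canRL (subrK _)) e := IH.
rewrite !psumS e /harmonic !psumS /dividx /= ?psumS; ring.
Qed.

(** C(p-1, n) / C(p-1, n-1) = (p - n) / n, so each step multiplies by 1 - p / n,
and the products of two terms p / n vanish. *)
Lemma binomial_harmonic p n : units_below B p -> (p ^ 2)%:R = 0 :> B ->
  (n < p)%N -> (-1) ^+ n * 'C(p.-1, n)%:R = 1 - p%:R * harmonic n :> B.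
Proof.
move=> up p2; elim: n => [|n IH] np.
  by rewrite bin0 /harmonic psum0 mulr0 subr0 mulr1.
have un := up n.+1 np.
have e : n.+1%:R * 'C(p.-1, n.+1)%:R = (p%:R - n.+1%:R) * 'C(p.-1, n)%:R :> B.
  rewrite -natrB 1?ltnW // -!natrM mul_bin_left.
  by case: (p) np => [//|q] _; rewrite subSS.
rewrite /harmonic psumS -/(harmonic n) /dividx mulr1.
set u := ring_inv _ in un *.
have -> : 'C(p.-1, n.+1)%:R = u * ((p%:R - n.+1%:R) * 'C(p.-1, n)%:R) :> B.
  by rewrite -e mulrA (mulrC u) un mul1r.
have -> : (-1) ^+ n.+1 * (u * ((p%:R - n.+1%:R) * 'C(p.-1, n)%:R)) =
    (n.+1%:R * u - p%:R * u) * ((-1) ^+ n * 'C(p.-1, n)%:R) :> B.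
  by rewrite exprS; ring.
rewrite un IH 1?ltnW //.
have pp : p%:R * p%:R = 0 :> B by rewrite -natrM mulnn.
transitivity (1 - p%:R * harmonic n - p%:R * u + p%:R * p%:R * (u * harmonic n)).
  by ring.
by rewrite pp; ring.
Qed.

(** The congruence for binomial coefficients at n = p - 1, where its left-hand
side is 1 because p - 1 is even. *)
Lemma harmonic_pred p : odd p -> units_below B p -> (p ^ 2)%:R = 0 :> B ->
  p%:R * harmonic p.-1 = 0.
Proof.
move=> op up p2; have p0 : (0 < p)%N by case: (p) op.
have := @binomial_harmonic p p.-1 up p2; rewrite prednK // => /(_ (leqnn _)).
have ep : odd p.-1 = false by case: (p) op => //= q /negbTE.
rewrite binn mulr1 -signr_odd ep expr0 => e.
by rewrite -[LHS](subKr 1) -e subrr.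
Qed.

(** * Star sums as iterated operators *)

(** The sum over N >= n_1 >= ... >= n_m >= 1 of g n_m / (n_1^k_1 ... n_m^k_m),
as a function of N; the recursion peels off the outermost index n_1. *)
Definition iterated_sum g (k : seq nat) : nat -> B :=
  foldr (fun a f => psum (iter a dividx f)) g k.

Lemma iter_dividx a f n : iter a dividx f n = ring_inv n%:R ^+ a * f n.
Proof.
by elim: a => [|a IH]; rewrite ?mul1r //= {1}/dividx IH exprS mulrA.
Qed.

(** The innermost D of [nest] is the letter that [word] leaves out, and each
sum of [iterated_sum] joins the last D of its block to form a letter D S. *)
Lemma iterated_sum_nest g a k : is_index (a :: k) ->
  iter a dividx (iterated_sum g k) = nest g (word (a :: k)).
Proof.
have nestF n w : nest g (nseq n false ++ w) = iter n dividx (nest g w).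
  by elim: n => //= n ->.
elim: k a => [|b k IH] a /andP[_ /= /andP[a0 hk]]; rewrite nestF.
  by rewrite /= -iterSr prednK.
by rewrite [nest g (true :: _)]/= -IH // -iterSr prednK.
Qed.

Lemma ring_inv_prod p m (n : 'I_m -> nat) (k : 'I_m -> nat) :
  units_below B p -> (forall i, 0 < n i < p)%N ->
  ring_inv (\prod_(i < m) (n i)%:R ^+ k i)
  = \prod_(i < m) ring_inv (n i)%:R ^+ k i :> B.
Proof.
move=> up np; apply: ring_invP; rewrite -big_split /= big1 // => i _.
by rewrite -exprMn up // expr1n.
Qed.

(** For the empty index, [last] returns its default value N, which makes the
statement uniform enough for an induction on k: the tail of a tuple with head i
is a tuple bounded by i, and its last entry has default value i. *)
Lemma tuple_sum g (k : seq nat) p N : (N < p)%N ->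
  \sum_(n : (size k).-tuple 'I_p
         | all (leq 1) (map val n) && path geq N (map val n))
    g (last N (map val n)) *
    \prod_(i < size k) ring_inv (tnth n i)%:R ^+ nth 0%N k i
  = iterated_sum g k N.
Proof.
elim: k N => [|a k IH] N Np.
  rewrite (big_pred1 [tuple]) => [|n]; first by rewrite big_ord0 mulr1.
  by rewrite [n]tuple0 /= eqxx.
rewrite /= /psum big_geq_mkord (big_ord_widen_cond p) //=.
(* Split off the first entry of each tuple. *)
pose cns (x : 'I_p * (size k).-tuple 'I_p) := [tuple of x.1 :: x.2].
rewrite (reindex cns); last first.
  exists (fun n => (thead n, [tuple of behead n])) => n _.
    by case: n => i n /=; congr (_, _); apply: val_inj.
  by rewrite [n in RHS]tuple_eta.
rewrite [RHS](eq_bigr (fun i : 'I_p => \sum_(n : (size k).-tuple 'I_p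
    | all (leq 1) (map val n) && path geq i (map val n))
    ring_inv i%:R ^+ a * (g (last (val i) (map val n)) *
    \prod_(j < size k) ring_inv (tnth n j)%:R ^+ nth 0%N k j))); last first.
  by move=> i _; rewrite iter_dividx -IH // mulr_sumr.
rewrite pair_big_dep; apply: eq_big => [[i n]|[i n] _] /=.
  rewrite ltnS; case: (0 < i)%N; case: (i <= N)%N; rewrite ?andbF ?andbT //.
rewrite big_ord_recl /= mulrCA; congr (_ * (_ * _)).
by apply: eq_bigr => j _; rewrite tnthS.
Qed.

Lemma star_sum_iterated p k x : units_below B p -> (0 < p)%N -> k != [::] ->
  star_sum p k x = iterated_sum (fun n => x ^+ n) k p.-1.
Proof.
move=> up p0 k0; rewrite -(@tuple_sum _ _ p) ?prednK //.
have nE (n : (size k).-tuple 'I_p) : exists i s, val n = i :: s.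
  by case: k k0 n => // a k _ [[|i s] //= _]; exists i, s.
apply: eq_big => [n|n /andP[/allP n1 _]].
  have [i [s ->]] := nE n.
  have ip : (val i <= p.-1)%N by rewrite -ltnS prednK ?ltn_ord.
  by rewrite /= ip.
rewrite (ring_inv_prod _ up) => [|i]; last first.
  by rewrite ltn_ord andbT n1 // map_f // mem_tnth.
by have [i [s ->]] := nE n.
Qed.

(** The functional equation at a single odd p, in any commutative ring in which p^2 = 0 and
1, ..., p - 1 are invertible. *)
Lemma star_sum_duality p k1 k x : odd p -> (p ^ 2)%:R = 0 :> B ->
  units_below B p -> is_index (k1 :: k) ->
  star_sum p (k1 :: k) x
    + (star_sum p [:: 1%N, k1 & k] x - star_sum p (k1.+1 :: k) x) * p%:R
  = star_sum p (hoffman_dual (k1 :: k)) (1 - x)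
    - star_sum p (hoffman_dual (k1 :: k)) 1.
Proof.
move=> op p2 up hk; have p0 : (0 < p)%N by case: (p) op.
have pp : (p.-1 < p)%N by rewrite prednK.
have := word_dual hk; have [hd _ _] := hoffman_dualP hk.
case: (hoffman_dual _) hd => // d1 d hd dw.
rewrite !star_sum_iterated // [iterated_sum _ (k1 :: k)]/=.
set s := iter k1 _ _.
rewrite -[iterated_sum _ [:: 1%N, k1 & k]]/(psum (dividx (psum s))).
rewrite -[iterated_sum _ (k1.+1 :: k)]/(psum (dividx s)).
rewrite harmonic_summation mulrC mulrBr mulrA (harmonic_pred op up p2).
rewrite mul0r sub0r.
transitivity (binomt s p.-1).
  rewrite /psum mulr_sumr -sumrB; apply: eq_big_nat => j; rewrite prednK //.
  move=> /andP[_ jp]; rewrite (binomial_harmonic up p2 jp).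
  by rewrite mulrBl mul1r mulrA.
rewrite /s iterated_sum_nest // (nest_duality _ _ up pp) -dw.
rewrite /= !iterated_sum_nest // -psumB; apply: psum_eq => n /andP[n0 _].
rewrite -nestB; apply: eq_nest => // j j0.
by rewrite binomt_pow expr1n.
Qed.

End Operators.

(** * From one prime to the ring A_2 *)

Section Reduction.

Set Implicit Arguments.
Unset Strict Implicit.

Lemma units_below_modsq (R : comPzRingType) p : prime p ->
  units_below (modsq R p) p.
Proof. by move=> pp n; apply: modsq_unit. Qed.

Lemma to_modsq_nat (R : comPzRingType) p n : to_modsq p n%:R = n%:R :> modsq R p.
Proof. by rewrite /to_modsq rmorph_nat. Qed.

Lemma to_modsq1 (R : comPzRingType) p : to_modsq p 1 = 1 :> modsq R p.
Proof. exact: rmorph1. Qed.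

Lemma sq_modsq (R : comPzRingType) p : (p ^ 2)%:R = 0 :> modsq R p.
Proof.
rewrite -to_modsq_nat; transitivity (to_modsq p (0 : R)); last exact: rmorph0.
by apply/to_modsq_eq; exists 1; rewrite subr0 mulr1.
Qed.

Section ModsqMap.
Variables (R S : comPzRingType) (f : {rmorphism R -> S}) (p : nat).

Lemma to_modsqK (a : modsq R p) : to_modsq p (repr a) = a.
Proof. exact: reprK. Qed.

Fact modsq_map_zmod_morphism : zmod_morphism (@modsq_map R S f p).
Proof.
move=> a b; rewrite -[a]to_modsqK -[b]to_modsqK !modsq_mapE.
by rewrite /to_modsq -!rmorphB modsq_mapE.
Qed.

Fact modsq_map_monoid_morphism : monoid_morphism (@modsq_map R S f p).
Proof.
split=> [|a b].
  by rewrite -to_modsq1 modsq_mapE rmorph1 to_modsq1.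
rewrite -[a]to_modsqK -[b]to_modsqK !modsq_mapE.
by rewrite /to_modsq -!rmorphM modsq_mapE.
Qed.

HB.instance Definition _ := GRing.isZmodMorphism.Build (modsq R p) (modsq S p)
  (@modsq_map R S f p) modsq_map_zmod_morphism.
HB.instance Definition _ := GRing.isMonoidMorphism.Build (modsq R p) (modsq S p)
  (@modsq_map R S f p) modsq_map_monoid_morphism.

End ModsqMap.

Lemma rmorph_star_sum (B C : comPzRingType) (f : {rmorphism B -> C}) p k x :
  units_below B p -> f (star_sum p k x) = star_sum p k (f x).
Proof.
move=> up; rewrite rmorph_sum; apply: eq_bigr => n /andP[/allP n1 _].
rewrite rmorphM rmorphXn; congr (_ * _); apply/esym/ring_invP.
transitivity (f (\prod_(i < size k) (tnth n i)%:R ^+ nth 0%N k i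
    * ring_inv (\prod_(i < size k) (tnth n i)%:R ^+ nth 0%N k i))).
  rewrite rmorphM rmorph_prod; congr (_ * _).
  by apply: eq_bigr => i _; rewrite rmorphXn rmorph_nat.
have np (i : 'I_(size k)) : (0 < tnth n i < p)%N.
  by rewrite ltn_ord andbT n1 // map_f // mem_tnth.
rewrite (ring_inv_prod _ up np) -big_split /= big1 ?rmorph1 // => i _.
by rewrite -exprMn up // expr1n.
Qed.

(** Components of the polylogarithm lie in quotients, so they are lifted to R
before the description of the induced map on lifts applies. *)
Lemma A2_map_polylog (R S : comPzRingType) (f : {rmorphism R -> S}) k x :
  A2_map f (polylog k x) = polylog k (f x).
Proof.
pose a (p : primeT) := star_sum (val p) k (to_modsq (val p) x).
have -> : polylog k x =
    toA2 (fun p : primeT => to_modsq (val p) (repr (a p))).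
  by rewrite /polylog; congr toA2; apply: functional_extensionality_dep => p;
     rewrite to_modsqK.
rewrite A2_mapE /polylog; congr toA2; apply: functional_extensionality_dep => p.
rewrite -modsq_mapE to_modsqK rmorph_star_sum; last first.
  exact: units_below_modsq (valP p).
by rewrite /= modsq_mapE.
Qed.

End Reduction.

Theorem mainTheorem8 (k1 : nat) (k : seq nat) (hk : is_index (k1 :: k)) :
  let t : {poly int} := 'X in
  let dual := hoffman_dual (k1 :: k) in
  polylog (k1 :: k) t
    + (polylog (1%N :: k1 :: k) t - polylog (k1.+1 :: k) t) * boldp {poly int}
  = polylog dual (1 - t) - A2_map polyC (zeta dual).
Proof.
move=> t dual; rewrite /zeta A2_map_polylog.
rewrite /polylog /boldp /toA2 -!rmorphB -rmorphM -rmorphD.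
apply/toA2_eq.
have p2 : prime 2 by [].
(* Only p = 2 has to be discarded, where H_{p-1} = 1. *)
apply: (sub_finite_set (B := [set exist _ 2%N p2]%classic)) => [p /= ne|]; last first.
  exact: finite_set1.
apply: contrapT => np; apply: ne; have pp := valP p.
have op : odd (val p).
  by case: (even_prime pp) => // e; case: np; apply: val_inj.
rewrite !prod_addE !prod_mulE !prod_addE !prod_oppE.
rewrite (star_sum_duality _ op) //; last exact: units_below_modsq.
  by rewrite /to_modsq rmorphB !rmorph1.
exact: sq_modsq.
Qed.
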